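(* Let $X$ be a separable complete metric space. For every non-negative real number $d<\dim_H(X)$ the space $X$ contains a compact subset $K\subset X$ of Hausdorff dimension $\dim_H(K)=d$.
   Context: $\dim_H$ denotes the Hausdorff dimension (with values in $[0,\infty]$) with respect to the given metric: for $s\ge0$, $\mathcal H^s(E)=\lim_{\varepsilon\to0}\mathcal H^s_\varepsilon(E)$, where $\mathcal H^s_\varepsilon(E)$ is the infimum of $\sum_{B\in\mathcal B}(\mathrm{diam}\,B)^s$ over all countable covers $\mathcal B$ of $E$ by sets of diameter $\le\varepsilon$, and $\dim_H(E)$ is the unique value such that $\mathcal H^s(E)=\infty$ for all $s<\dim_H(E)$ and $\mathcal H^s(E)=0$ for all $s>\dim_H(E)$. *)

(* Defs.v *)
From HB Require Import structures.
From mathcomp Require Import all_boot all_order all_algebra.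
From mathcomp Require Import all_classical all_reals all_analysis.

Set Implicit Arguments.
Unset Strict Implicit.
Unset Printing Implicit Defensive.

Import Order.TTheory GRing.Theory Num.Theory.
Import numFieldNormedType.Exports.

Local Open Scope classical_set_scope.
Local Open Scope ring_scope.
Local Open Scope ereal_scope.

(* The axiom of [completeType], without the base point that this structure
   carries, so that the empty space is allowed. *)
Definition complete_space (T : uniformType) : Prop :=
  forall F : set_system T, ProperFilter F -> cauchy F -> exists x : T, F --> x.

Definition separable_space (T : topologicalType) : Prop :=
  exists2 D : set T, countable D & dense D.

Section hausdorff.
Context {R : realType} {X : metricType R}.
Implicit Types (E U : set X) (s eps : R).

(* [ereal_sup set0 = -oo], hence the [maxe]: the diameter of [set0] is 0. *)
Definition diameter U : \bar R :=
  maxe 0 (ereal_sup [set (mdist x y)%:E | x in U & y in U]).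

Definition countable_cover eps E : set (set (set X)) :=
  [set B | [/\ countable B, E `<=` \bigcup_(U in B) U &
               forall U, B U -> diameter U <= eps%:E]].

(* For [s = 0], [poweR] has [0 `^ 0 = 1]. *)
Definition hausdorff_premeasure s eps E : \bar R :=
  ereal_inf [set \esum_(U in B) (diameter U `^ s) | B in countable_cover eps E].

Definition hausdorff_measure s E : \bar R :=
  lim (hausdorff_premeasure s eps E @[eps --> 0%R^'+]).

Definition is_hausdorff_dim E (D : \bar R) : Prop :=
  [/\ 0 <= D,
      forall s, (0 <= s)%R -> s%:E < D -> hausdorff_measure s E = +oo &
      forall s, (0 <= s)%R -> D < s%:E -> hausdorff_measure s E = 0].

(* The default value 0 is never used: see [hausdorff_dimP]. *)
Definition hausdorff_dim E : \bar R := xget 0 [set D | is_hausdorff_dim E D].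

Lemma diameter_ge0 U : 0 <= diameter U.
Proof. by rewrite /diameter le_max lexx. Qed.

Lemma hausdorff_premeasure_ge0 s eps E : 0 <= hausdorff_premeasure s eps E.
Proof.
apply: le_ereal_inf_tmp => _ [B _ <-].
by apply: esum_ge0 => U _; exact: poweR_ge0.
Qed.

Lemma hausdorff_premeasure_nincr s E e1 e2 : (e1 <= e2)%R ->
  hausdorff_premeasure s e2 E <= hausdorff_premeasure s e1 E.
Proof.
move=> e12; apply: ereal_inf_le_tmp => _ [B [cB EB dB] <-].
exists B => //; split=> // U BU.
by rewrite (le_trans (dB _ BU))// lee_fin.
Qed.

Lemma hausdorff_measureE s E :
  hausdorff_measure s E =
  ereal_sup [set hausdorff_premeasure s eps E | eps in `]0%R, +oo[%classic].
Proof.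
apply/cvg_lim => //; apply: (@nonincreasing_at_right_cvge R _ 0%R +oo%O) => //.
by move=> e1 e2 _ _; exact: hausdorff_premeasure_nincr.
Qed.

Lemma hausdorff_measure_ge0 s E : 0 <= hausdorff_measure s E.
Proof.
rewrite hausdorff_measureE; apply: le_ereal_sup_tmp.
exists (hausdorff_premeasure s 1 E); last exact: hausdorff_premeasure_ge0.
by exists 1%R => //=; rewrite in_itv/= ltr01.
Qed.

Lemma hausdorff_premeasure_le s eps E : (0 < eps)%R ->
  hausdorff_premeasure s eps E <= hausdorff_measure s E.
Proof.
move=> e0; rewrite hausdorff_measureE; apply: ereal_sup_ubound.
by exists eps => //=; rewrite in_itv/= e0.
Qed.

Lemma diameter_poweR_le s t eps U : (0 <= s)%R -> (s < t)%R ->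
  diameter U <= eps%:E ->
  diameter U `^ t <= (eps `^ (t - s))%:E * diameter U `^ s.
Proof.
move=> s0 st; have := diameter_ge0 U; case: (diameter U) => // r.
rewrite lee_fin => r0; rewrite lee_fin => re.
have tE : (t = t - s + s)%R by rewrite subrK.
rewrite !poweR_EFin [in leLHS]tE powRD; last first.
  by rewrite -tE gt_eqF// (le_lt_trans s0).
rewrite EFinM lee_wpmul2r ?lee_fin ?powR_ge0// ge0_ler_powR ?nnegrE//.
  by rewrite subr_ge0 ltW.
exact: le_trans re.
Qed.

Lemma hausdorff_premeasure_exp s t eps E :
  (0 <= s)%R -> (s < t)%R -> (0 < eps)%R ->
  hausdorff_premeasure t eps E <=
  (eps `^ (t - s))%:E * hausdorff_premeasure s eps E.
Proof.
move=> s0 st e0; rewrite -lee_pdivrMl ?powR_gt0//.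
apply: le_ereal_inf_tmp => _ [B [cB EB dB] <-].
rewrite lee_pdivrMl ?powR_gt0//.
apply: (@le_trans _ _ (\esum_(U in B) (diameter U `^ t))).
  by apply: ereal_inf_lbound; exists B.
apply: ge_ereal_sup => _ [A [finA AB] <-].
apply: (@le_trans _ _
    (\sum_(U \in A) (eps `^ (t - s))%:E * (diameter U `^ s))).
  rewrite !fsbig_finite//= big_seq [leRHS]big_seq.
  apply: lee_sum => U; rewrite in_fset_set// inE => AU.
  by apply: diameter_poweR_le => //; exact/dB/AB.
rewrite -ge0_mule_fsumr; last by move=> U; exact: poweR_ge0.
rewrite lee_wpmul2l ?lee_fin ?powR_ge0//.
by apply: ereal_sup_ubound; exists A.
Qed.

Lemma hausdorff_measure_eq0 s t E : (0 <= s)%R -> (s < t)%R ->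
  hausdorff_measure s E < +oo -> hausdorff_measure t E = 0.
Proof.
move=> s0 st Hfin; apply/eqP; rewrite eq_le hausdorff_measure_ge0 andbT.
have := fun e => @hausdorff_premeasure_le s e E.
have := hausdorff_measure_ge0 s E.
move: Hfin; case: (hausdorff_measure s E) => // m _; rewrite lee_fin => m0 Hm.
have ts0 : (0 < t - s)%R by rewrite subr_gt0.
have m10 : (0 < m + 1)%R by rewrite ltr_wpDl.
rewrite hausdorff_measureE; apply: ge_ereal_sup => _ [e /= e0 <-].
rewrite in_itv/= andbT in e0.
apply/lee_addgt0Pr => d d0; rewrite add0e.
pose e' := Num.min e ((d / (m + 1)) `^ (t - s)^-1)%R.
have e'0 : (0 < e')%R by rewrite lt_min e0 powR_gt0// divr_gt0.
apply: (le_trans (@hausdorff_premeasure_nincr t E e' e _)).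
  by rewrite ge_min lexx.
apply: (le_trans (hausdorff_premeasure_exp E s0 st e'0)).
apply: (@le_trans _ _ ((e' `^ (t - s))%:E * m%:E)).
  by rewrite lee_wpmul2l ?lee_fin ?powR_ge0// Hm.
rewrite -EFinM lee_fin.
apply: (@le_trans _ _ (d / (m + 1) * (m + 1))%R); last first.
  by rewrite divfK// gt_eqF.
apply: ler_pM; rewrite ?powR_ge0 ?lerDl//.
apply: (@le_trans _ _ (((d / (m + 1)) `^ (t - s)^-1) `^ (t - s))%R).
  rewrite ge0_ler_powR ?nnegrE ?powR_ge0 ?(ltW ts0) ?(ltW e'0)//.
  by rewrite ge_min lexx orbT.
by rewrite -powRrM mulVf ?gt_eqF// powRr1// divr_ge0 ?ltW.
Qed.

Lemma is_hausdorff_dim_exists E : exists D, is_hausdorff_dim E D.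
Proof.
pose S := [set s%:E |
  s in [set s : R | (0 <= s)%R /\ hausdorff_measure s E = +oo]].
exists (maxe 0 (ereal_sup S)); split; first by rewrite le_max lexx.
- move=> s s0; rewrite lt_max => /orP[|/ereal_sup_gt[_ [t [t0 Ht] <-]]].
    by rewrite lte_fin => /(le_lt_trans s0); rewrite ltxx.
  rewrite lte_fin => st; apply/eqP; rewrite -leye_eq leNgt; apply/negP.
  by move=> /(hausdorff_measure_eq0 s0 st); rewrite Ht.
- move=> s s0; rewrite gt_max => /andP[]; rewrite lte_fin => sgt0 Ss.
  have [t [t0 ts St]] : exists t,
      [/\ (0 <= t)%R, (t < s)%R & ereal_sup S < t%:E].
    move: Ss; case: (ereal_sup S) => [r||] //.
    + rewrite lte_fin => rs; exists ((Num.max 0 r + s) / 2)%R.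
      have ms : (Num.max 0 r < s)%R by rewrite gt_max sgt0.
      have := midf_lt ms => -[m1 m2]; split => //.
        by rewrite (le_trans _ (ltW m1))// le_max lexx.
      by rewrite lte_fin (le_lt_trans _ m1)// le_max lexx orbT.
    + by move=> _; exists 0%R; rewrite ltNyr.
  apply: (hausdorff_measure_eq0 t0 ts); rewrite ltey; apply/eqP => Ht.
  move: St; rewrite ltNge => /negP; apply.
  by apply: ereal_sup_ubound; exists t.
Qed.

Lemma is_hausdorff_dim_unique E D1 D2 :
  is_hausdorff_dim E D1 -> is_hausdorff_dim E D2 -> D1 = D2.
Proof.
wlog D12 : D1 D2 / D1 < D2.
  move=> W h1 h2; have [D12|D21|//] := ltgtP D1 D2; first exact: W.
  by apply/esym; exact: W.
move=> [D10 _ H1] [_ H2 _]; exfalso.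
have [s s1 s2] : exists2 s : R, D1 < s%:E & s%:E < D2.
  move: D10 D12; case: D1 {H1} => [r| |]//; case: D2 {H2} => [r'| |]//.
    rewrite lte_fin => _ rr'; exists ((r + r') / 2)%R; rewrite lte_fin.
      by have [] := midf_lt rr'.
    by have [] := midf_lt rr'.
  by move=> _ _; exists (r + 1)%R; rewrite ?ltry// lte_fin ltrDl.
have s0 : (0 <= s)%R by rewrite -lee_fin (le_trans D10)// ltW.
by have := H1 _ s0 s1; rewrite (H2 _ s0 s2).
Qed.

Lemma hausdorff_dimP E D : hausdorff_dim E = D <-> is_hausdorff_dim E D.
Proof.
have dimE : is_hausdorff_dim E (hausdorff_dim E).
  exact: (@xgetPex _ 0 [set D | is_hausdorff_dim E D]
            (is_hausdorff_dim_exists E)).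
by split=> [<- //|/(is_hausdorff_dim_unique dimE)].
Qed.

End hausdorff.

(* Main.v *)
Require Import Defs.
From mathcomp Require Import all_boot all_order all_algebra.
From mathcomp Require Import all_classical all_reals all_analysis.
From mathcomp Require Import ring lra.

(** Assume [0 < d].  Since [H^d(X)] is positive, the [d]-dimensional content is
    positive, and outside a null set every point [x] is the centre of
    arbitrarily small balls [B(x, r)] of content at least [c r^d]; call them
    good.  Inside a good ball [B(p, r)] a family of much smaller good balls
    [B(q, r_q)] is selected by maximality under the constraint
      (the sum of [r_q^d] over the [q] in [B(y, rho)] with [r_q <= rho])
        [<= 2 rho^d]   for all [y] and [rho].
    By maximality every good point lies in a ball for which the constraint is
    nearly an equality, so Vitali's covering argument bounds the sum of all
    [r_q^d] below by a constant times [r^d]; a second Vitali argument thins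
    out the family to a finite separated one.  Iterating gives a finitely
    branching tree of balls whose limit set [K] is compact.  The sums of
    [r_q^d] over the levels of the tree grow at most geometrically, whereas
    covers of [K] lose at most a geometric factor per level; as the radii
    decrease superexponentially these factors are harmless for every exponent
    other than [d], and [K] has dimension [d]. *)

Local Open Scope classical_set_scope.
Local Open Scope ereal_scope.

Set Implicit Arguments.
Unset Strict Implicit.
Unset Printing Implicit Defensive.

Import Order.TTheory GRing.Theory Num.Theory.

(** * Finite sums and enumerations *)

Section finite_sums.
Local Open Scope ring_scope.
Context {R : realType}.

(** For nonnegative [f] this bounds the possibly infinite sum over [A], while all values stay in
    [R]. *)
Definition finsum_le (T : eqType) (A : set T) (f : T -> R) (b : R) : Prop :=
  forall s, uniq s -> (forall x, x \in s -> A x) -> \sum_(x <- s) f x <= b.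

Lemma sum_uniq_sub (T : eqType) (s s' : seq T) (f : T -> R) :
  uniq s -> {subset s <= s'} -> (forall x, x \in s' -> 0 <= f x) ->
  \sum_(x <- s) f x <= \sum_(x <- s') f x.
Proof.
elim: s s' => [|x s IH] s' /=.
  by rewrite big_nil big_seq => _ _ f0; exact: sumr_ge0.
move=> /andP[xs us] ss' f0; have xs' : x \in s' by rewrite ss'// mem_head.
rewrite big_cons (big_rem x xs')/= lerD2l; apply: IH => //.
  move=> y ys; apply: rem_mem; first by apply: contraNneq xs => <-.
  by rewrite ss'// inE ys orbT.
by move=> y /mem_rem; exact: f0.
Qed.

(** The sets may overlap: each entry of the list is charged to a single index [k x]. *)
Lemma finsum_le_bigcup (I T : eqType) (J : set I) (A : I -> set T)
    (a : I -> R) (f : T -> R) b :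
  (forall i, J i -> finsum_le (A i) f (a i)) -> finsum_le J a b ->
  finsum_le (\bigcup_(i in J) A i) f b.
Proof.
move=> Aa Jb [|x0 s0].
  by move=> _ _; have := Jb [::] isT; rewrite !big_nil; apply.
set s := x0 :: s0 => us sA.
have [i0 _ _] := sA _ (mem_head x0 s0).
have /choice[k kP] : forall x, exists i, x \in s -> J i /\ A i x.
  move=> x; have [/sA[i Ji Ai]|] := boolP (x \in s); first by exists i.
  by exists i0.
have sub (l : seq I) : uniq l -> (forall i, i \in l -> J i) ->
    \sum_(x <- s | k x \in l) f x <= \sum_(i <- l) a i.
  elim: l => [_ _|i l IH /= /andP[il ul] lJ].
    by rewrite big_pred0// big_nil.
  rewrite big_cons (bigID (fun x => k x == i))/= lerD//.
    rewrite (eq_bigl (fun x => k x == i)); last first.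
      by move=> x; rewrite inE; case: eqP; rewrite ?andbT ?andbF.
    rewrite -big_filter; apply: Aa; [|exact: filter_uniq|].
      by apply: lJ; rewrite mem_head.
    by move=> x; rewrite mem_filter => /andP[/eqP <- /kP[]].
  rewrite (eq_bigl (fun x => k x \in l)).
    by apply: IH => // j jl; apply: lJ; rewrite inE jl orbT.
  move=> x; rewrite inE; case: eqP => [->|_]; rewrite ?andbT//.
  by rewrite (negbTE il).
apply: le_trans (Jb (undup (map k s)) (undup_uniq _) _); last first.
  by move=> i; rewrite mem_undup => /mapP[x /kP[? _] ->].
apply: le_trans (sub _ (undup_uniq _) _); last first.
  by move=> i; rewrite mem_undup => /mapP[x /kP[? _] ->].
rewrite big_seq [leRHS]big_seq_cond.
rewrite [leRHS](eq_bigl (fun x => x \in s))// => x.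
by have [xs|//] := boolP (x \in s); rewrite mem_undup map_f.
Qed.

Lemma finsum_le_set1 (T : eqType) (x : T) (f : T -> R) b :
  0 <= f x <= b -> finsum_le [set x] f b.
Proof.
move=> /andP[fx0 fxb] s us sx; apply: le_trans fxb.
have <- : \sum_(y <- [:: x]) f y = f x by rewrite big_seq1.
apply: sum_uniq_sub => //.
  by move=> y /sx ->; rewrite inE.
by move=> y; rewrite inE => /eqP ->.
Qed.

Lemma finsum_le_image (T T' : eqType) (A : set T) (f : T -> T') (g : T' -> R)
    (h : T -> R) b :
  (forall x, A x -> 0 <= g (f x) <= h x) -> finsum_le A h b ->
  finsum_le (f @` A) g b.
Proof.
move=> gh; have -> : f @` A = \bigcup_(x in A) [set f x].
  by rewrite eqEsubset; split=> [_ [x Ax <-]|y [x Ax ->]]; exists x.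
by apply: finsum_le_bigcup => x /gh; exact: finsum_le_set1.
Qed.

Lemma finsum_le_geometric (T : eqType) (A : set T) (k : T -> nat) b :
  0 <= b -> {in A &, injective k} ->
  finsum_le A (fun x => b / 2 ^+ (k x).+1) b.
Proof.
move=> b0 kinj s us sA.
have uks : uniq (map k s).
  rewrite map_inj_in_uniq// => x y /sA Ax /sA Ay; apply: kinj; exact: mem_set.
rewrite -(big_map k xpredT (fun n => b / 2 ^+ n.+1)).
have geo N : \sum_(0 <= n < N) b / 2 ^+ n.+1 = b - b / 2 ^+ N :> R.
  elim: N => [|N IH]; first by rewrite big_geq// expr0 divr1 subrr.
  rewrite big_nat_recr//= IH exprS invfM.
  by set z := (2 ^+ N)^-1; lra.
pose N := (\max_(n <- map k s) n).+1.
apply: (@le_trans _ _ (\sum_(0 <= n < N) b / 2 ^+ n.+1)).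
  apply: sum_uniq_sub => //.
    move=> n ns; rewrite mem_index_iota/= ltnS.
    exact: (@leq_bigmax_seq _ _ _ id).
  by move=> n _; rewrite divr_ge0// exprn_ge0.
by rewrite geo gerBl divr_ge0// exprn_ge0.
Qed.

Lemma esum_le_finsum (T : choiceType) (A : set T) (f : T -> \bar R) (b : \bar R) :
  (\esum_(x in A) f x <= b)%E <->
  forall s, uniq s -> (forall x, x \in s -> A x) -> (\sum_(x <- s) f x <= b)%E.
Proof.
split=> [Ab s us sA|fb].
  apply: le_trans Ab; apply: esum_ge; exists [set` s].
    by split; [exact: finite_seq|move=> x /= /sA].
  by rewrite fsbig_seq.
apply: ge_ereal_sup => _ [F [finF FA] <-].
rewrite fsbig_finite//; apply: fb; first exact: finmap.fset_uniq.
by move=> x; rewrite in_fset_set// inE => /FA.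
Qed.

End finite_sums.

(** Pigeonhole principle for ultrafilters; it will single out one ball on each level of the tree. *)
Lemma ultra_seq (T : Type) (F : set_system T) (I : eqType) (s : seq I)
    (A : I -> set T) :
  UltraFilter F -> F [set x | exists2 i, i \in s & A i x] ->
  exists2 i, i \in s & F (A i).
Proof.
move=> FU; elim: s => [|i s IH] Fs.
  exfalso; apply: (@filter_not_empty _ F); apply: filterS Fs => x [].
  by [].
have [Ai|nAi] := in_ultra_setVsetC (A i) FU; first by exists i; rewrite ?mem_head.
have [|j js Aj] := IH; last by exists j => //; rewrite inE js orbT.
apply: filterS (filterI Fs nAi) => x [[j]].
by rewrite inE => /predU1P[->//|js] Ajx _; exists j.
Qed.

(** Feeds a countable cover to the compactness argument in finite stages; stage [n] lists the
    elements of code below [n]. *)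
Lemma countable_exhaustion (T : eqType) (C : set T) : countable C ->
  exists S : nat -> seq T, [/\ forall n, uniq (S n),
    forall n c, c \in S n -> C c, forall m n, (m <= n)%N -> {subset S m <= S n} &
    forall c, C c -> exists n, c \in S n].
Proof.
move=> /countable_injP[k kinj].
have /choice[e eP] : forall i, exists o : option T,
    (forall c, o = Some c -> C c) /\ (forall c, C c -> k c = i -> o = Some c).
  move=> i; have [[c [Cc kc]]|nC] := pselect (exists c, C c /\ k c = i).
    exists (Some c); split=> [_ [<-]//|c' Cc' kc'].
    by congr Some; apply: kinj; rewrite ?inE// kc.
  by exists None; split=> // c Cc kc; case: nC; exists c.
have memS n c : c \in undup (pmap e (iota 0 n)) <->
    exists2 i, (i < n)%N & e i = Some c.
  rewrite mem_undup mem_pmap.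
  split=> [/mapP[i]|[i lt_in ei]]; first by rewrite mem_iota => lt_in ->; exists i.
  by apply/mapP; exists i; rewrite ?mem_iota.
exists (fun n => undup (pmap e (iota 0 n))); split.
- by move=> n; exact: undup_uniq.
- by move=> n c /memS[i _ /(eP i).1].
- move=> m n mn c /memS[i im ei]; apply/memS; exists i => //.
  exact: leq_trans mn.
- move=> c Cc; exists (k c).+1; apply/memS; exists (k c) => //.
  exact: (eP _).2.
Qed.


(** * Vitali's covering argument *)

Section vitali.
Local Open Scope ring_scope.
Context {R : realType}.

(** By Zorn's lemma: if a maximal family missed some index, a missed index of nearly maximal radius
    could be added to it. *)
Lemma vitali_selection (I : Type) (D : set I) (meet : I -> I -> Prop)
    (rho : I -> R) M :
  (forall i, D i -> meet i i) -> (forall i j, meet i j -> meet j i) ->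
  (forall i, D i -> 0 < rho i <= M) ->
  exists G : set I, [/\ G `<=` D,
    forall i j, G i -> G j -> meet i j -> i = j &
    forall i, D i -> exists2 j, G j & meet i j /\ rho i <= 2 * rho j].
Proof.
move=> meetxx meetC rhoM.
(* The third clause concerns only indices that meet [G], so it passes to unions of chains. *)
pose P (G : set I) := [/\ G `<=` D,
    forall i j, G i -> G j -> meet i j -> i = j &
    forall i, D i -> (exists2 j, G j & meet i j) ->
      exists2 j, G j & meet i j /\ rho i <= 2 * rho j].
have /Zorn_bigcup[G [[GD Gdisj Gbig] Gmax]] : forall F : set (set I),
    F `<=` P -> total_on F subset -> P (\bigcup_(H in F) H).
  move=> F FP Ftot; split.
  - by move=> i [G /FP[GD _ _] /GD].
  - move=> i j [G FG Gi] [H FH Hj]; have [GH|HG] := Ftot _ _ FG FH.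
      by have [_ + _] := FP _ FH; apply => //; exact: GH.
    by have [_ + _] := FP _ FG; apply => //; exact: HG.
  - move=> i Di [j [G FG Gj] ij]; have [_ _ /(_ _ Di)] := FP _ FG.
    by case=> [|j' Gj' ?]; [exists j|exists j' => //; exists G].
exists G; split=> // i0 Di0; apply: (Gbig) => //; apply: contrapT => Gi0.
pose S := [set rho i | i in [set i | D i /\ ~ exists2 j, G j & meet i j]].
have S0 : S (rho i0) by exists i0.
have supS : has_sup S.
  split; first by exists (rho i0).
  by exists M => _ [i [/rhoM/andP[_ ?] _] <-].
have sup0 : 0 < sup S / 2.
  rewrite divr_gt0//; apply: lt_le_trans (ub_le_sup supS.2 S0).
  by case/andP: (rhoM _ Di0).
(* The radius of [i1] exceeds half of [sup S], hence half the radius of any missed index. *)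
have [_ [i1 [Di1 Gi1] <-] i1big] := sup_adherent sup0 supS.
apply: (Gmax (G `|` [set i1])); first split.
- by move=> i Gi; left.
- by move=> sub; apply: Gi1; exists i1; [apply: sub; right|exact: meetxx].
split.
- by move=> i [/GD//|->].
- move=> i j [Gi|->] [Gj|->]//.
  + exact: Gdisj.
  + by move=> /meetC i1i; case: Gi1; exists i.
  + by move=> i1j; case: Gi1; exists j.
- move=> i Di [j Gj ij].
  have [Gi|Gi] := pselect (exists2 j, G j & meet i j).
    by have [j' Gj' ?] := Gbig _ Di Gi; exists j' => //; left.
  case: Gj => [Gj|ji1]; first by case: Gi; exists j.
  rewrite {}ji1 in ij.
  exists i1; [by right|split => //].
  have : rho i <= sup S by apply: ub_le_sup; [exact: supS.2|exists i].
  by move: i1big; lra.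
Qed.

End vitali.

(** * Hausdorff content *)

Section content.
Local Open Scope ring_scope.
Context {R : realType} {X : metricType R}.
Implicit Types (E : set X) (t a b : R).

(* [covered t E a] says that the [t]-dimensional Hausdorff content of [E],
   computed with countable covers by open balls, represented by the pairs
   (centre, radius), is at most [a] and that the bound is attained. *)
Definition covered t E a : Prop := exists C : set (X * R),
  [/\ countable C, forall c, C c -> 0 < c.2,
      E `<=` \bigcup_(c in C) ball c.1 c.2 &
      finsum_le C (fun c => c.2 `^ t) a].

(** For [0 < t] this amounts to vanishing Hausdorff measure: a small sum forces all radii to be
    small. *)
Definition null t E : Prop := forall a, 0 < a -> covered t E a.

Lemma covered_le t E E' a a' : E `<=` E' -> a' <= a ->
  covered t E' a' -> covered t E a.
Proof.
move=> EE' aa' [C [cC C0 CE' Ca]]; exists C; split => //.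
  exact: subset_trans CE'.
by move=> s us sC; rewrite (le_trans (Ca s us sC)).
Qed.

Lemma covered_ball t x r : 0 < r -> covered t (ball x r : set X) (r `^ t).
Proof.
move=> r0; exists [set (x, r)]; split.
- exact: finite_set_countable.
- by move=> _ ->.
- by move=> y xy; exists (x, r).
- by apply: finsum_le_set1; rewrite powR_ge0/=.
Qed.

Lemma covered_bigcup (I : choiceType) (J : set I) t (E : I -> set X)
    (a : I -> R) b :
  countable J -> (forall i, J i -> covered t (E i) (a i)) ->
  finsum_le J a b -> covered t (\bigcup_(i in J) E i) b.
Proof.
move=> cJ Ea Jb.
have /choice[C CP] : forall i, exists C : set (X * R), J i ->
  [/\ countable C, forall c, C c -> 0 < c.2,
      E i `<=` \bigcup_(c in C) ball c.1 c.2 &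
      finsum_le C (fun c => c.2 `^ t) (a i)].
  move=> i; have [/Ea[C ?]|nJ] := pselect (J i); first by exists C.
  by exists set0.
exists (\bigcup_(i in J) C i); split.
- by apply: bigcup_countable => // i /CP[].
- by move=> c [i /CP[_ + _ _]]; apply.
- move=> x [i Ji Eix]; have [_ _ + _] := CP _ Ji.
  by move=> /(_ _ Eix)[c Cc ?]; exists c => //; exists i.
- by apply: finsum_le_bigcup Jb => i /CP[].
Qed.

Lemma covered_setU t E E' a a' : covered t E a -> covered t E' a' ->
  0 <= a -> 0 <= a' -> covered t (E `|` E') (a + a').
Proof.
move=> Ea Ea' a0 a0'.
have -> : E `|` E' = \bigcup_(i in [set: bool]) if i then E else E'.
  by rewrite eqEsubset; split=> [x [?|?]|x [[] _ ?]]; by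
    [exists true|exists false|left|right].
apply: (@covered_bigcup _ _ _ _ (fun i => if i then a else a')).
- exact: countableP.
- by case.
- move=> s us _; apply: le_trans (sum_uniq_sub (s' := [:: true; false]) us _ _) _.
  + by case; rewrite !inE.
  + by case.
  + by rewrite big_cons big_seq1.
Qed.

Lemma null_bigcup (I : choiceType) (J : set I) t (E : I -> set X) :
  countable J -> (forall i, J i -> null t (E i)) ->
  null t (\bigcup_(i in J) E i).
Proof.
move=> cJ E0 a a0.
have /countable_injP[k kinj] := cJ.
apply: (@covered_bigcup _ _ _ _ (fun i => a / 2 ^+ (k i).+1)) => //.
  by move=> i Ji; apply: E0 => //; rewrite divr_gt0// exprn_gt0.
exact: finsum_le_geometric (ltW a0) kinj.
Qed.

(** The gap [b - a] pays for a cover of [N]. *)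
Lemma covered_diff_null t E N a b : null t N -> covered t (E `\` N) a ->
  0 <= a -> a < b -> covered t E b.
Proof.
move=> N0 Ea a0 ab; have ba : 0 < b - a by rewrite subr_gt0.
apply: (@covered_le _ _ ((E `\` N) `|` N) _ (a + (b - a))).
- by move=> x Ex; have [?|?] := pselect (N x); [right|left].
- by rewrite addrC subrK.
- by apply: covered_setU => //; [exact: N0|exact: ltW].
Qed.

End content.

Section powR_facts.
Local Open Scope ring_scope.
Context {R : realType}.
Implicit Types x y t a : R.

Lemma powR_le x y t : 0 <= t -> 0 <= x -> x <= y -> x `^ t <= y `^ t.
Proof.
move=> t0 x0 xy; apply: ge0_ler_powR => //; rewrite nnegrE//.
exact: le_trans xy.
Qed.

Lemma powR_lt x y t : 0 < t -> 0 <= x -> x < y -> x `^ t < y `^ t.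
Proof.
move=> t0 x0 xy; apply: gt0_ltr_powR => //; rewrite nnegrE//.
exact/ltW/(le_lt_trans x0).
Qed.

Lemma powR_lt_root x a t : 0 < t -> 0 <= a -> x `^ t < a -> x < a `^ t^-1.
Proof.
move=> t0 a0 xa; rewrite ltNge; apply/negP => /(powR_le (ltW t0) (powR_ge0 _ _)).
by rewrite -powRrM mulVf ?gt_eqF// powRr1// leNgt xa.
Qed.

Lemma powR_le_inv x y t : 0 < t -> 0 <= y -> x `^ t <= y `^ t -> x <= y.
Proof.
move=> t0 y0 xy; rewrite leNgt; apply/negP => /(powR_lt t0 y0).
by rewrite ltNge xy.
Qed.

Lemma root_powR a t : 0 < t -> 0 <= a -> (a `^ t^-1) `^ t = a.
Proof. by move=> t0 a0; rewrite -powRrM mulVf ?gt_eqF// powRr1. Qed.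

End powR_facts.

(** * Null sets for the content and for the Hausdorff measure *)

Section hausdorff_content.
Local Open Scope ring_scope.
Context {R : realType} {X : metricType R}.
Implicit Types (E U : set X) (t a : R).

Lemma ballP (x y : X) (r : R) : ball x r y <-> mdist x y < r.
Proof. by rewrite ballEmdist. Qed.

Lemma covered_set0 t a : 0 <= a -> covered t (set0 : set X) a.
Proof.
move=> a0; exists set0; split => // s us s0.
by case: s us s0 => [|x s] _ s0; [rewrite big_nil|case: (s0 _ (mem_head _ _))].
Qed.

Lemma mdist_le_diameter U x y : U x -> U y ->
  ((mdist x y)%:E <= diameter U)%E.
Proof.
move=> Ux Uy; rewrite /diameter le_max; apply/orP; right.
by apply: ereal_sup_ubound; exists x => //; exists y.
Qed.

Lemma diameter_ball_le (x : X) r : 0 <= r -> (diameter (ball x r) <= (2 * r)%:E)%E.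
Proof.
move=> r0; rewrite /diameter ge_max lee_fin mulr_ge0//=.
apply: ge_ereal_sup => _ [y /ballP xy [z /ballP xz <-]].
rewrite lee_fin; have := metric_triangle y x z.
by rewrite (metric_sym y x); move: xy xz; lra.
Qed.

Lemma diam_ball_fin (x : X) r : 0 <= r -> diameter (ball x r) \is a fin_num.
Proof.
move=> r0; rewrite ge0_fin_numE ?diameter_ge0//.
by rewrite (le_lt_trans (diameter_ball_le _ r0))// ltry.
Qed.

(** By the strict inequality the radius a^(1/t) exceeds the diameter, so an open ball around any
    point of [U] contains [U]. *)
Lemma covered_diameter t U a : 0 < t -> (diameter U < +oo)%E ->
  fine (diameter U) `^ t < a -> covered t U a.
Proof.
move=> t0 dU dUa; have a0 : 0 < a by exact: le_lt_trans (powR_ge0 _ _) dUa.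
have [->|/set0P[x Ux]] := eqVneq U set0; first exact/covered_set0/ltW.
rewrite -(root_powR t0 (ltW a0)).
apply: (@covered_le _ _ _ _ (ball x (a `^ t^-1)) _ ((a `^ t^-1) `^ t)) => //.
  move=> y Uy; apply/ballP; apply: le_lt_trans (powR_lt_root t0 (ltW a0) dUa).
  rewrite -lee_fin fineK; first exact: mdist_le_diameter.
  by rewrite ge0_fin_numE ?diameter_ge0.
by apply: covered_ball; rewrite powR_gt0.
Qed.

Lemma hausdorff_measure0_null t E : 0 < t ->
  hausdorff_measure t E = 0%E -> null t E.
Proof.
move=> t0 E0 a a0.
have /ereal_inf_lt[_ [B [cB EB dB] <-] Ba] :
    (hausdorff_premeasure t 1 E < (a / 2)%:E)%E.
  apply: le_lt_trans (hausdorff_premeasure_le _ _ ltr01) _.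
  by rewrite E0 lte_fin divr_gt0.
have /countable_injP[k kinj] := cB.
(* Half of [a] is kept as slack for enclosing each [U] in an open ball. *)
pose eta U : R := (a / 2) / 2 ^+ (k U).+1.
have eta0 U : 0 < eta U by rewrite !divr_gt0// exprn_gt0.
have dfin U : B U -> (diameter U < +oo)%E.
  by move=> /dB /le_lt_trans; apply; rewrite ltry.
have : covered t (\bigcup_(U in B) U) a; last exact: covered_le EB _.
apply: (@covered_bigcup _ _ _ _ _ _ (fun U => fine (diameter U) `^ t + eta U)) => //.
  move=> U BU; apply: covered_diameter => //; first exact: dfin.
  by rewrite ltrDl.
move=> s us sB; rewrite big_split/= [leRHS](splitr a) lerD//; last first.
  by apply: (finsum_le_geometric _ kinj us sB); rewrite divr_ge0// ltW.
rewrite -lee_fin -sumEFin; apply: le_trans (ltW Ba).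
have /esum_le_finsum/(_ s us sB) := @lexx _ _ (\esum_(U in B) (diameter U `^ t)%E).
apply: le_trans; rewrite big_seq [leRHS]big_seq; apply: lee_sum => U /sB /dfin dU.
by rewrite -poweR_EFin fineK// ge0_fin_numE ?diameter_ge0.
Qed.

Lemma null_hausdorff_measure0 t E : 0 < t ->
  null t E -> hausdorff_measure t E = 0%E.
Proof.
move=> t0 E0; apply/eqP; rewrite eq_le hausdorff_measure_ge0 andbT.
rewrite hausdorff_measureE; apply: ge_ereal_sup => _ [e /= e0 <-].
rewrite in_itv/= andbT in e0.
apply/lee_addgt0Pr => b b0; rewrite add0e.
(* The first bound makes all radii at most [e / 2]; the second absorbs the factor 2^t between radii
   and diameters. *)
pose a := Num.min ((e / 2) `^ t) (b / 2 `^ t).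
have [|C [cC C0 EC Ca]] := E0 a.
  by rewrite lt_min powR_gt0 ?divr_gt0 ?powR_gt0.
pose f (c : X * R) := ball c.1 c.2.
have Cle c : C c -> 2 * c.2 <= e.
  move=> Cc; rewrite -ler_pdivlMl// mulrC.
  apply: (powR_le_inv t0); first by rewrite divr_ge0// ltW.
  have : c.2 `^ t <= a.
    by have := Ca [:: c] isT; rewrite big_seq1; apply => x; rewrite inE => /eqP ->.
  by move/le_trans; apply; rewrite ge_min lexx.
apply: (@le_trans _ _ (\esum_(U in f @` C) (diameter U `^ t))%E).
  apply: ereal_inf_lbound; exists (f @` C) => //; split.
  - exact: sub_countable (card_le_trans (card_image_le _ _) _).
  - by move=> x /EC[c Cc ?]; exists (f c) => //; exists c.
  - move=> _ [c Cc <-]; apply: le_trans (diameter_ball_le _ (ltW (C0 _ Cc))) _.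
    by rewrite lee_fin Cle.
have Cb : finsum_le (f @` C) (fun U => fine (diameter U) `^ t) b.
  apply: (@finsum_le_image _ _ _ _ _ _ (fun c => 2 `^ t * c.2 `^ t)).
    move=> c Cc; rewrite powR_ge0/= -powRM//; last exact/ltW/C0.
    apply: powR_le; [exact: ltW|by rewrite fine_ge0// diameter_ge0|].
    rewrite -lee_fin fineK; first exact/diameter_ball_le/ltW/C0.
    exact/diam_ball_fin/ltW/C0.
  move=> s us sC; rewrite -mulr_sumr mulrC -ler_pdivlMr ?powR_gt0//.
  by rewrite (le_trans (Ca s us sC))// ge_min lexx orbT.
apply/esum_le_finsum => s us sC; have := Cb _ us sC.
rewrite -lee_fin -sumEFin; apply: le_trans; rewrite big_seq [leRHS]big_seq.
apply: lee_sum => U /sC[c Cc <-].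
by rewrite -poweR_EFin fineK//; exact/diam_ball_fin/ltW/C0.
Qed.

End hausdorff_content.

(** * Lower density of the content *)

Section density.
Local Open Scope ring_scope.
Context {R : realType} {X : metricType R} (d : R).
Implicit Types (E : set X).
Hypothesis separable_X : separable_space X.
Hypothesis d0 : 0 < d.

(** Chosen so that the bound for radius [2 * r] is half of r^d, which drives the halving below. *)
Definition density_cst : R := (2 `^ (d + 1))^-1.

Lemma density_cst_gt0 : 0 < density_cst.
Proof. by rewrite invr_gt0 powR_gt0. Qed.

Definition dense_ball (x : X) r := 0 < r /\ ~ covered d (ball x r) (density_cst * r `^ d).

Definition thin eps : set X := [set x | forall r, r <= eps -> ~ dense_ball x r].

Lemma density_cst_double r : 0 < r ->
  density_cst * (2 * r) `^ d = 2^-1 * r `^ d.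
Proof.
move=> r0; rewrite /density_cst powRM ?(ltW r0)// powRD ?pnatr_eq0 ?implybT//.
rewrite powRr1// invfM mulrA; congr (_ * _).
by rewrite mulrAC mulVf ?mul1r// gt_eqF// powR_gt0.
Qed.

(* A cover of [ball z (2 * r)] with [z] thin consists of balls of radius at
   most [r], to which the assumed bound applies in turn. *)
Lemma thin_halve eps (theta : R) : 0 <= theta ->
  (forall x r, 0 < r <= eps / 2 ->
     covered d (thin eps `&` ball x r) (theta * r `^ d)) ->
  forall x r, 0 < r <= eps / 2 ->
     covered d (thin eps `&` ball x r) (theta / 2 * r `^ d).
Proof.
move=> theta0 IH x r /andP[r0 re].
have [[z [zthin /ballP xz]]|nz] := pselect (exists z, (thin eps `&` ball x r) z);
    last first.
  apply: (@covered_le _ _ _ _ set0 _ (theta / 2 * r `^ d)) => //.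
    by move=> y xy; apply: nz; exists y.
  by apply: covered_set0; rewrite mulr_ge0 ?powR_ge0 ?divr_ge0.
have : covered d (ball z (2 * r)) (density_cst * (2 * r) `^ d).
  apply: contrapT => zr; apply: (zthin (2 * r)); first by move: re; lra.
  by split => //; rewrite mulr_gt0.
rewrite density_cst_double// => -[C [cC C0 zC Cr]].
apply: (@covered_le _ _ _ _
    (\bigcup_(c in C) (thin eps `&` ball c.1 c.2)) _ (theta / 2 * r `^ d)) => //.
  move=> y [ythin /ballP xy]; have /zC[c Cc cy] : ball z (2 * r) y.
    apply/ballP; have := metric_triangle z x y; rewrite (metric_sym z x).
    by move: xz xy; lra.
  by exists c.
apply: (@covered_bigcup _ _ _ _ _ _ (fun c => theta * c.2 `^ d)) => //.
  move=> c Cc; apply: IH; rewrite C0//=; apply: le_trans re.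
  apply: (powR_le_inv d0); first exact: ltW.
  have := Cr [:: c] isT; rewrite big_seq1 => /(_ _)/le_trans; apply.
    by move=> x'; rewrite inE => /eqP ->.
  by rewrite ler_piMl ?powR_ge0// invf_le1// ler1n.
move=> s us sC; rewrite -mulr_sumr -mulrA ler_wpM2l//.
exact: Cr.
Qed.

(** Iterated halving makes the thin part of each ball of radius [eps / 2] null; by separability
    countably many such balls suffice. *)
Lemma thin_null eps : 0 < eps -> null d (thin eps).
Proof.
move=> eps0.
have thinN n : forall x r, 0 < r <= eps / 2 ->
    covered d (thin eps `&` ball x r) ((2^-1) ^+ n * r `^ d).
  elim: n => [|n IH] x r re.
    rewrite expr0 mul1r; apply: (@covered_le _ _ _ _ (ball x r) _ (r `^ d)) => //.
    by apply: covered_ball; case/andP: re.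
  by rewrite exprSr; apply: thin_halve => //; rewrite exprn_ge0// invr_ge0.
have [D cD dD] := separable_X.
have eps20 : 0 < eps / 2 by rewrite divr_gt0.
have -> : thin eps = \bigcup_(x in D) (thin eps `&` ball x (eps / 2)).
  rewrite eqEsubset; split=> [x tx|x [y _ []]//].
  have [|y [/interior_subset/ballP xy Dy]] := dD _ _ (open_interior (ball x (eps / 2))).
    exists x; exact: nbhsx_ballx.
  by exists y => //; split => //; apply/ballP; rewrite metric_sym.
apply: null_bigcup => // x _ a a0; set b := (eps / 2) `^ d.
pose n := Num.bound (b / a).
apply: covered_le (thinN n x (eps / 2) _); [by []| |by rewrite eps20 lexx].
rewrite exprVn [leLHS]mulrC ler_pdivrMr ?exprn_gt0// [leRHS]mulrC -ler_pdivrMr//.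
by apply/ltW/(@upper_nthrootP _ (b / a)).
Qed.

Definition regular : set X :=
  [set x | forall eps, 0 < eps -> exists2 r, r <= eps & dense_ball x r].

Lemma null_nonregular : null d (~` regular).
Proof.
have : null d (\bigcup_(n in [set: nat]) thin (n.+1%:R^-1)).
  apply: null_bigcup => [|n _]; first exact: countableP.
  apply: thin_null; by rewrite invr_gt0.
move=> N a /N; apply: covered_le => // x /existsNP[eps /not_implyP[eps0 xeps]].
have neps : (Num.trunc eps^-1).+1%:R^-1 <= eps.
  by rewrite -[leRHS]invrK lef_pV2 ?posrE ?invr_gt0// ltW// truncnS_gt.
exists (Num.trunc eps^-1) => // r rn xr; apply: xeps; exists r => //.
exact: le_trans neps.
Qed.

Lemma dense_ball_regular x r : dense_ball x r ->
  ~ covered d (regular `&` ball x r) (density_cst / 2 * r `^ d).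
Proof.
move=> [r0 xr] rx; apply: xr; apply: (covered_diff_null null_nonregular).
- apply: covered_le rx => [y []|]; last exact: lexx.
  by move=> xy /contrapT.
- by rewrite mulr_ge0 ?powR_ge0 ?divr_ge0// ltW// density_cst_gt0.
- by rewrite ltr_pM2r ?powR_gt0// gtr_pMr ?density_cst_gt0// invf_lt1 ?ltr1n.
Qed.

End density.

(** * Selection of separated families of balls *)

Section selection.
Local Open Scope ring_scope.
Context {R : realType} {X : metricType R} (d : R).
Implicit Types (E P : set X).
Hypothesis separable_X : separable_space X.
Hypothesis d0 : 0 < d.

Section fixed_radii.
Context (r : X -> R).

(** A Frostman-type growth condition. The clause [r x <= rho] lets singletons satisfy it; with the
    factor 2, a violation caused by one added point leaves weight at least rho^d to the others. *)
Definition upper_regular P := forall y rho, 0 <= rho ->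
  finsum_le (P `&` [set x | ball y rho x /\ r x <= rho])
            (fun x => r x `^ d) (2 * rho `^ d).

Definition balls_meet (y : X -> X) (rho : X -> R) (i j : X) :=
  exists z, ball (y i) (rho i) z /\ ball (y j) (rho j) z.

Lemma balls_meetC y rho i j : balls_meet y rho i j -> balls_meet y rho j i.
Proof. by move=> [z [? ?]]; exists z. Qed.

Lemma total_on_seq (F : set (set X)) (s : seq X) : total_on F subset ->
  s != [::] -> (forall x, x \in s -> (\bigcup_(H in F) H) x) ->
  exists2 H, F H & forall x, x \in s -> H x.
Proof.
move=> Ftot; elim: s => // x s IH _ sF.
have [H FH Hx] := sF x (mem_head _ _).
have [->|s0] := eqVneq s [::].
  by exists H => // z; rewrite inE => /eqP ->.
have [|H' FH' sH'] := IH s0.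
  by move=> z zs; apply: sF; rewrite inE zs orbT.
have [HH'|H'H] := Ftot _ _ FH FH'.
  by exists H' => // z; rewrite inE => /predU1P[->|/sH'//]; exact: HH'.
by exists H => // z; rewrite inE => /predU1P[->//|/sH']; exact: H'H.
Qed.

(** The constraint involves only finite subsets, so it passes to unions of chains. *)
Lemma maximal_upper_regular E : exists2 P, P `<=` E /\ upper_regular P &
  forall P', P `<` P' -> P' `<=` E -> ~ upper_regular P'.
Proof.
pose A := [set P | P `<=` E /\ upper_regular P].
have /Zorn_bigcup[P [[PE Pr] Pmax]] : forall F : set (set X),
    F `<=` A -> total_on F subset -> A (\bigcup_(H in F) H).
  move=> F FP Ftot; split.
    by move=> x [H FH Hx]; have [HE _] := FP _ FH; exact: HE.
  move=> y rho rho0 s us sF.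
  have [->|s0] := eqVneq s [::]; first by rewrite big_nil mulr_ge0 ?powR_ge0.
  have [H FH sH] : exists2 H, F H & forall x, x \in s -> H x.
    by apply: total_on_seq => // x /sF[].
  have [_ Hr] := FP _ FH; apply: (Hr y rho rho0 s us).
  by move=> x xs; have [_ ?] := sF _ xs; split; [exact: sH|].
by exists P => // P' PP' P'E P'r; exact: (Pmax _ PP').
Qed.

(** If [x] is not in [P], adding it violates the constraint in some ball; there [x] weighs at most
    rho^d, so the points of [P] weigh at least rho^d. The triple [c] consists of centre, radius and
    these points. *)
Lemma maximal_saturated E P : (forall x, E x -> 0 < r x) ->
  P `<=` E -> upper_regular P ->
  (forall P', P `<` P' -> P' `<=` E -> ~ upper_regular P') ->
  forall x, E x -> exists c : X * R * seq X,
    [/\ 0 < c.1.2, ball c.1.1 c.1.2 x, uniq c.2,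
        forall z, z \in c.2 -> P z /\ ball c.1.1 c.1.2 z &
        c.1.2 `^ d <= \sum_(z <- c.2) r z `^ d].
Proof.
move=> r0 PE Pr Pmax x Ex.
have [Px|nPx] := pselect (P x).
  exists (x, r x, [:: x]); split => //=.
  - exact: r0.
  - by apply/ballP; rewrite mdistxx r0.
  - by move=> z; rewrite inE => /eqP ->; split => //; apply/ballP; rewrite mdistxx r0.
  - by rewrite big_seq1.
have : ~ upper_regular (P `|` [set x]).
  apply: Pmax; first split.
  - by move=> z Pz; left.
  - by move=> /(_ x)/=; apply/not_implyP; split => //; right.
  - by move=> z [/PE|->].
move=> /existsNP[y /existsNP[rho /not_implyP[rho0 /existsNP[s]]]].
move=> /not_implyP[us /not_implyP[sP /negP]]; rewrite -ltNge => ssum.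
have xs : x \in s.
  apply: contraPT ssum => xs; apply/negP; rewrite -leNgt; apply: (Pr y rho rho0 s us) => z zs.
  by have [[Pz|zx] ?] := sP _ zs; [|rewrite -zx zs in xs].
have [_ [yx rx]] := sP _ xs.
exists (y, rho, rem x s); split => //=.
- exact: lt_le_trans (r0 _ Ex) rx.
- exact: rem_uniq.
- move=> z; rewrite mem_rem_uniq// inE => /andP[zx /sP[[Pz|zx'] [yz _]]] //.
  by rewrite zx' eqxx in zx.
- move: ssum; rewrite (big_rem x)//=.
  by have := powR_le (ltW d0) (ltW (r0 _ Ex)) rx; lra.
Qed.

(** Disjoint balls have disjoint lists of points of [P], which can be concatenated. *)
Lemma disjoint_saturated_sum P (y : X -> X) (rho : X -> R) (s_ : X -> seq X) G b :
  (forall i, G i -> [/\ uniq (s_ i),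
     forall z, z \in s_ i -> P z /\ ball (y i) (rho i) z &
     rho i `^ d <= \sum_(z <- s_ i) r z `^ d]) ->
  (forall i j, G i -> G j -> balls_meet y rho i j -> i = j) ->
  finsum_le P (fun x => r x `^ d) b -> finsum_le G (fun i => rho i `^ d) b.
Proof.
move=> sat disj Pb s us sG.
suff [s' [us' s'P ss']] : exists s' : seq X, [/\ uniq s',
    forall z, z \in s' -> P z /\ exists2 i, i \in s & ball (y i) (rho i) z &
    \sum_(i <- s) rho i `^ d <= \sum_(z <- s') r z `^ d].
  by apply: le_trans ss' (Pb _ us' _) => z /s'P[].
elim: s us sG => [_ _|i s IH /= /andP[si us] sG].
  by exists [::]; rewrite !big_nil.
have [|s' [us' s'P ss']] := IH us.
  by move=> j js; apply: sG; rewrite inE js orbT.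
have Gi : G i by apply: sG; rewrite mem_head.
have [ui siP sumi] := sat i Gi.
exists (s_ i ++ s'); split.
- rewrite cat_uniq ui us' andbT/=; apply/hasPn => z /s'P[_ [j js jz]].
  apply/negP => /siP[_ iz]; move: si; rewrite (disj i j) ?js//.
    by apply: sG; rewrite inE js orbT.
  by exists z.
- move=> z; rewrite mem_cat => /orP[/siP[Pz iz]|/s'P[Pz [j js jz]]].
    by split => //; exists i; rewrite ?mem_head.
  by split => //; exists j; rewrite // inE js orbT.
- by rewrite big_cons big_cat lerD.
Qed.

Lemma disjoint_balls_countable (y : X -> X) (rho : X -> R) (G : set X) :
  (forall i, G i -> 0 < rho i) ->
  (forall i j, G i -> G j -> balls_meet y rho i j -> i = j) -> countable G.
Proof.
move=> rho0 disj; have [D cD dD] := separable_X.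
have /choice[q qP] : forall i, exists q, G i -> D q /\ ball (y i) (rho i) q.
  move=> i; have [Gi|] := pselect (G i); last by exists i.
  have [|q [/interior_subset iq Dq]] := dD _ _ (open_interior (ball (y i) (rho i))).
    by exists (y i); exact/nbhsx_ballx/rho0.
  by exists q.
have /countable_injP[k kinj] := cD.
apply/countable_injP; exists (k \o q) => i j /set_mem Gi /set_mem Gj /= kij.
have [Dqi qi] := qP _ Gi; have [Dqj qj] := qP _ Gj.
apply: disj => //; exists (q i); split => //.
by rewrite (kinj _ _ _ _ kij)// mem_set.
Qed.

(** Otherwise the 5-fold enlargements of a Vitali family of saturated balls would cover [E] at cost
    [a]. *)
Lemma upper_regular_large E P (p : X) r0 a : 0 < r0 ->
  E `<=` ball p r0 -> (forall x, E x -> 0 < r x <= r0) -> ~ covered d E a ->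
  P `<=` E -> upper_regular P ->
  (forall P', P `<` P' -> P' `<=` E -> ~ upper_regular P') ->
  ~ finsum_le P (fun x => r x `^ d) (a / 5 `^ d).
Proof.
move=> r00 Ep rE Ea PE Pr Pmax Pa; apply: Ea.
have r0' x : E x -> 0 < r x by move=> /rE/andP[].
have /choice[c cP] : forall x, exists c : X * R * seq X, E x ->
    [/\ 0 < c.1.2, ball c.1.1 c.1.2 x, uniq c.2,
        forall z, z \in c.2 -> P z /\ ball c.1.1 c.1.2 z &
        c.1.2 `^ d <= \sum_(z <- c.2) r z `^ d].
  move=> x; have [Ex|] := pselect (E x); last by exists (x, 0, [::]).
  by have [c ?] := maximal_saturated r0' PE Pr Pmax Ex; exists c.
pose y x := (c x).1.1; pose rho x := (c x).1.2.
have rho_gt0 x : E x -> 0 < rho x by move=> /cP[].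
(* Vitali's argument needs bounded radii: a saturated ball weighs at least rho^d, and upper
   regularity in [ball p r0] bounds this by 2 r0^d. *)
have rho_le x : E x -> 0 < rho x <= (2 * r0 `^ d) `^ d^-1.
  move=> Ex; rewrite rho_gt0//=; have [_ _ us sP sat] := cP _ Ex.
  apply: (powR_le_inv d0); rewrite ?powR_ge0//.
  rewrite root_powR// ?mulr_ge0 ?powR_ge0//; apply: le_trans sat _.
  apply: (Pr p r0 (ltW r00) _ us) => z /sP[/[dup] Pz /PE Ez _]; split => //.
  by split; [exact: Ep|case/andP: (rE _ Ez)].
have [||G [GE Gdisj Gbig]] := vitali_selection (meet := balls_meet y rho) _ _ rho_le.
- by move=> x /cP[_ ? _ _ _]; exists x.
- by move=> i j; exact: balls_meetC.
have cG : countable G.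
  by apply: (disjoint_balls_countable (y := y) (rho := rho)) => // i /GE/rho_gt0.
have Ga : finsum_le G (fun i => rho i `^ d) (a / 5 `^ d).
  apply: disjoint_saturated_sum Gdisj Pa => i /GE/cP[_ _ us sP sat]; split.
  - exact: us.
  - exact: sP.
  - exact: sat.
exists ((fun i => (y i, 5 * rho i)) @` G); split.
- exact: sub_countable (card_image_le _ _) cG.
- by move=> _ [i /GE/rho_gt0 ? <-]; rewrite mulr_gt0.
- move=> x /[dup] Ex /Gbig[j Gj [[z [/ballP xz /ballP jz] xj]]].
  exists (y j, 5 * rho j); first by exists j.
  have [_ /ballP yx _ _ _] := cP _ Ex; apply/ballP => /=.
  have := metric_triangle (y j) z x; have := metric_triangle z (y x) x.
  rewrite (metric_sym z (y x)); move: yx xz jz xj; rewrite -/(y x) -/(rho x); lra.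
- apply: (@finsum_le_image _ _ _ _ _ _ (fun i => 5 `^ d * rho i `^ d)).
    move=> i /GE/rho_gt0 i0; rewrite powR_ge0/= powRM//; exact: ltW.
  move=> s us sG; rewrite -mulr_sumr mulrC -ler_pdivlMr ?powR_gt0//.
  exact: Ga.
Qed.

(** Vitali's argument selects disjoint balls of radius [8 * r q]. The balls of radius [24 * r q]
    then contain all of [s], and upper regularity bounds the weight lost in each. *)
Lemma separated_subset P (s : seq X) : upper_regular P ->
  (forall x, P x -> 0 < r x) -> uniq s -> (forall x, x \in s -> P x) ->
  exists s' : seq X, [/\ uniq s', {subset s' <= s},
    \sum_(x <- s) r x `^ d <= 2 * 24 `^ d * \sum_(x <- s') r x `^ d &
    forall x y, x \in s' -> y \in s' -> x != y -> 8 * r x <= mdist x y].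
Proof.
move=> Pr r0 us sP; pose rho x := 8 * r x.
have rM x : [set` s] x -> 0 < r x <= \sum_(z <- s) r z.
  move=> /= xs; rewrite r0//=; last exact: sP.
  rewrite (big_rem x)//= lerDl big_seq sumr_ge0// => z /mem_rem zs.
  exact/ltW/r0/sP.
have [||G [Gs Gdisj Gbig]] := vitali_selection (meet := balls_meet id rho) _ _ rM.
- move=> x /= xs; exists x; split; apply/ballP; rewrite mdistxx mulr_gt0//;
  exact/r0/sP.
- by move=> i j; exact: balls_meetC.
pose s' := [seq x <- s | `[< G x >]].
have s'E x : x \in s' -> x \in s /\ G x by rewrite mem_filter => /andP[/asboolP].
exists s'; split.
- exact: filter_uniq.
- by move=> x /s'E[].
- have sub : finsum_le (\bigcup_(q in G)
      (P `&` [set x | ball q (24 * r q) x /\ r x <= 24 * r q]))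
      (fun x => r x `^ d) (2 * 24 `^ d * \sum_(x <- s') r x `^ d).
    apply: (@finsum_le_bigcup _ _ _ _ _ (fun q => 2 * (24 * r q) `^ d)).
      by move=> q /Gs/sP/r0 q0; apply: Pr; rewrite mulr_ge0// ltW.
    move=> t ut tG; apply: (@le_trans _ _ (\sum_(q <- t) 2 * 24 `^ d * r q `^ d)).
      rewrite big_seq [leRHS]big_seq ler_sum// => q /tG/Gs/sP/r0 q0.
      by rewrite powRM ?mulrA// ltW.
    rewrite -mulr_sumr ler_wpM2l ?mulr_ge0 ?powR_ge0//; apply: sum_uniq_sub => //.
    - by move=> x /[dup] /tG Gx; rewrite mem_filter (Gs _ Gx) andbT => _; apply/asboolP.
    - by move=> x _; exact: powR_ge0.
  apply: sub => // x xs; have [q Gq [[z [/ballP xz /ballP qz] xq]]] := Gbig _ xs.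
  exists q => //; split; first exact: sP.
  have q0 : 0 < r q by exact/r0/sP/Gs.
  split; last by move: xq q0; lra.
  apply/ballP; have := metric_triangle q z x; rewrite (metric_sym z x).
  by move: xz qz xq; rewrite /rho/=; lra.
- move=> x y /s'E[xs Gx] /s'E[ys Gy]; apply: contraNT; rewrite -ltNge => xy.
  apply/eqP/Gdisj => //; exists y; split; apply/ballP => //.
  by rewrite mdistxx mulr_gt0//; exact/r0/sP.
Qed.

End fixed_radii.

(* The factor 5 is Vitali's enlargement of the saturated balls; 24 = 8 + 8 * 2
   is the enlargement needed for the separation by 8 radii. *)
Lemma frostman_selection E (r : X -> R) (p : X) r0 a : 0 < r0 ->
  E `<=` ball p r0 -> (forall x, E x -> 0 < r x <= r0) -> ~ covered d E a ->
  exists s : seq X, [/\ uniq s, forall x, x \in s -> E x,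
    a <= 2 * 120 `^ d * \sum_(x <- s) r x `^ d,
    forall y rho, 0 <= rho ->
      \sum_(x <- s | (mdist y x < rho) && (r x <= rho)) r x `^ d <= 2 * rho `^ d &
    forall x y, x \in s -> y \in s -> x != y -> 8 * r x <= mdist x y].
Proof.
move=> r00 Ep rE Ea; have [P [PE Pr] Pmax] := maximal_upper_regular r E.
have /existsNP[s /not_implyP[us /not_implyP[sP /negP]]] :=
  upper_regular_large r00 Ep rE Ea PE Pr Pmax.
rewrite -ltNge => sa.
have r0' x : P x -> 0 < r x by move=> /PE/rE/andP[].
have [s' [us' s's ss' sep]] := separated_subset Pr r0' us sP.
exists s'; split => //.
- by move=> x /s's/sP/PE.
- have -> : 120 = 5 * 24 :> R by rewrite -natrM.
  rewrite powRM// mulrCA -mulrA mulrC -ler_pdivrMr ?powR_gt0//.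
  by rewrite -mulrA (le_trans (ltW sa))// mulrA.
- move=> y rho rho0; rewrite -big_filter; apply: (Pr y rho rho0).
    exact: filter_uniq.
  move=> x; rewrite mem_filter => /andP[/andP[yx xrho] /s's/sP Px].
  by split => //; split => //; exact/ballP.
Qed.

End selection.

(** * Children of a good ball *)

Section children.
Local Open Scope ring_scope.
Context {R : realType} {X : metricType R} (d : R).

Definition good_node (p : X * R) := regular d p.1 /\ dense_ball d p.1 p.2.

(** The numerator [density_cst d / 2] is the content density left to the regular points of a good
    ball; the denominator is the loss in the selection. *)
Definition mass_cst : R := density_cst d / 2 / (2 * 120 `^ d).

Record child_family (good : X * R -> Prop) (kappa : R) (p : X * R) (eps : R)
    (s : seq (X * R)) : Prop := ChildFamily {
  child_uniq : uniq s;
  child_good : forall q, q \in s -> good q;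
  child_ball : forall q, q \in s -> ball p.1 p.2 q.1;
  child_radius : forall q, q \in s -> q.2 <= eps;
  child_mass : kappa * p.2 `^ d <= \sum_(q <- s) q.2 `^ d;
  child_regular : forall y rho, 0 <= rho ->
    \sum_(q <- s | (mdist y q.1 < rho) && (q.2 <= rho)) q.2 `^ d <=
    2 * rho `^ d;
  child_separated : forall q q', q \in s -> q' \in s -> q != q' ->
    8 * q.2 <= mdist q.1 q'.1
}.

Hypothesis separable_X : separable_space X.
Hypothesis d0 : 0 < d.

Lemma mass_cst_gt0 : 0 < mass_cst.
Proof. by rewrite !divr_gt0 ?density_cst_gt0// mulr_gt0// powR_gt0. Qed.

Lemma mass_cst_le : mass_cst <= 2^-1.
Proof.
have le1 (x t : R) : 0 <= t -> 1 <= x -> 1 <= x `^ t.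
  by move=> t0 x1; have := powR_le t0 ler01 x1; rewrite powR1.
rewrite /mass_cst -mulrA -[leRHS]mul1r; apply: ler_pM.
- exact/ltW/density_cst_gt0.
- by rewrite divr_ge0// invr_ge0 mulr_ge0// powR_ge0.
- by rewrite invf_le1 ?powR_gt0// le1 ?ler1n// addr_ge0// ltW.
- rewrite ler_piMr// invf_le1 ?mulr_gt0 ?powR_gt0//.
  by have := le1 120 d (ltW d0); rewrite ler1n => /(_ isT); lra.
Qed.

Lemma child_family_exists p eps : good_node p -> 0 < eps ->
  exists s, child_family good_node mass_cst p eps s.
Proof.
move=> [_ pdense] eps0; have [p0 _] := pdense.
have min0 : 0 < Num.min eps p.2 by rewrite lt_min eps0.
have /choice[r rP] : forall x : X, exists r : R, regular d x ->
    r <= Num.min eps p.2 /\ dense_ball d x r.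
  move=> x; have [xreg|] := pselect (regular d x); last by exists 0.
  by have [r ? ?] := xreg _ min0; exists r.
have rE x : (regular d `&` ball p.1 p.2) x -> 0 < r x <= p.2.
  move=> [/rP[rle [rx0 _]] _]; rewrite rx0/= (le_trans rle)//.
  by rewrite ge_min lexx orbT.
have Ep : regular d `&` ball p.1 p.2 `<=` ball p.1 p.2 by move=> x [].
have [s [us sE ssum sreg ssep]] := frostman_selection separable_X d0 p0 Ep rE
  (dense_ball_regular separable_X d0 pdense).
have inj : injective (fun x => (x, r x)) by move=> x y [].
exists (map (fun x => (x, r x)) s); split.
- by rewrite map_inj_uniq.
- by move=> _ /mapP[x /sE[/[dup] xr /rP[_ ?] _] ->].
- by move=> _ /mapP[x /sE[_ ?] ->].
- move=> _ /mapP[x /sE[/rP[rle _] _] ->] /=; apply: le_trans rle _.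
  by rewrite ge_min lexx.
- rewrite big_map/= /mass_cst mulrAC ler_pdivrMr ?mulr_gt0 ?powR_gt0//.
  by rewrite [leRHS]mulrC.
- by move=> y rho rho0; rewrite big_map; exact: sreg.
- move=> _ _ /mapP[x xs ->] /mapP[y ys ->] xy /=; apply: ssep => //.
  by apply: contraNN xy => /eqP ->.
Qed.

End children.

(** * Trees of balls *)

Section tree.
Local Open Scope ring_scope.
Context {R : realType} {X : metricType R} (d kappa : R).
Context (good : X * R -> Prop) (ch : nat -> X * R -> seq (X * R)).
Hypothesis d0 : 0 < d.
Hypothesis kappa0 : 0 < kappa.
Hypothesis kappa_le : kappa <= 2^-1.
Hypothesis good_gt0 : forall p, good p -> 0 < p.2.

(** The square in the exponent makes [kappa ^- m] harmless against any positive power of the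
    scale. *)
Definition scale m : R := kappa ^+ (m * m).

Hypothesis chP : forall m p, good p ->
  child_family d good kappa p (Num.min (scale m.+1) (p.2 / 2)) (ch m p).

(* The [k]-th generation of descendants of a node [p] of level [m]. *)
Fixpoint desc m k p : seq (X * R) :=
  if k is k'.+1 then flatten [seq desc m.+1 k' q | q <- ch m p] else [:: p].

Let kappa_le1 : kappa <= 1.
Proof. by rewrite (le_trans kappa_le)// invf_le1 ?ler1n. Qed.

Lemma scale_gt0 m : 0 < scale m. Proof. exact: exprn_gt0. Qed.

Lemma scale_le m n : (m <= n)%N -> scale n <= scale m.
Proof.
move=> mn; apply: ler_wiXn2l; [exact: ltW|exact: kappa_le1|exact: leq_mul].
Qed.

Lemma scale_eventually_le e : 0 < e -> exists m, scale m <= e.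
Proof.
move=> e0; pose n := Num.bound e^-1; exists n.
have en : e^-1 < 2 ^+ n by apply: (@upper_nthrootP _ e^-1).
apply: (@le_trans _ _ (kappa ^+ n)).
  apply: ler_wiXn2l; [exact: ltW|exact: kappa_le1|].
  by case: (n) => // k; rewrite leq_pmulr.
apply: (@le_trans _ _ (2^-1 ^+ n)); first by apply: lerXn2r => //; rewrite nnegrE ?invr_ge0// ltW.
by rewrite exprVn -[leRHS]invrK lef_pV2 ?posrE ?exprn_gt0 ?invr_gt0// ltW.
Qed.

(* The exponent of [kappa] is the quadratic [m ^ 2 * u - m], which is bounded
   below by [- 1 / (4 * u)]. *)
Lemma scale_decay (u : R) : 0 < u ->
  exists2 B : R, 0 < B & forall m, kappa ^- m * scale m `^ u <= B.
Proof.
move=> u0; exists (kappa `^ (- (4 * u)^-1)); first exact: powR_gt0.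
move=> m; rewrite /scale -!powR_mulrn ?(ltW kappa0)// -powRN -powRrM -powRD; last first.
  by rewrite (gt_eqF kappa0) implybT.
apply: ger_powR; first by rewrite kappa0.
rewrite natrM -subr_ge0.
have -> : - m%:R + m%:R * m%:R * u - - (4 * u)^-1 = u * (m%:R - (2 * u)^-1) ^+ 2.
  by field; rewrite gt_eqF.
by rewrite mulr_ge0 ?sqr_ge0// ltW.
Qed.

(** A child has its centre in the ball of its parent and at most half the radius, so doubled balls
    are nested. *)
Lemma desc_subset m k p q x : good p -> q \in desc m k p ->
  mdist q.1 x <= 2 * q.2 -> mdist p.1 x <= 2 * p.2.
Proof.
elim: k m p => [|k IH] m p gp /=; first by rewrite inE => /eqP ->.
move=> /flatten_mapP[c cch qc] qx; have [_ cg cb cr _ _ _] := chP m gp.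
have := IH _ _ (cg _ cch) qc qx; have /ballP := cb _ cch.
have := cr _ cch; rewrite le_min => /andP[_].
by have := metric_triangle p.1 c.1 x; lra.
Qed.

Lemma desc_good m k p q : good p -> q \in desc m k p -> good q.
Proof.
elim: k m p => [|k IH] m p gp /=; first by rewrite inE => /eqP ->.
move=> /flatten_mapP[c cch]; apply: IH.
by have [_ cg _ _ _ _ _] := chP m gp; exact: cg.
Qed.

Lemma desc_scale m k p q : good p -> p.2 <= scale m -> q \in desc m k p ->
  q.2 <= scale (m + k).
Proof.
elim: k m p => [|k IH] m p gp pm /=; first by rewrite inE addn0 => /eqP ->.
move=> /flatten_mapP[c cch qc]; have [_ cg _ cr _ _ _] := chP m gp.
rewrite -addSnnS; apply: IH qc; first exact: cg.
by have := cr _ cch; rewrite le_min => /andP[].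
Qed.

(** Since [desc] branches at the root, the parent of a node of the last generation is reached by
    induction. *)
Lemma desc_parent m k p q x : good p -> q \in desc m k.+1 p ->
  mdist q.1 x <= 2 * q.2 ->
  exists2 q', q' \in desc m k p & mdist q'.1 x <= 2 * q'.2.
Proof.
elim: k m p => [|k IH] m p gp.
  by move=> qp qx; exists p; [rewrite /= inE|exact: (desc_subset gp qp)].
move=> /flatten_mapP[c cch qc] qx; have [_ cg _ _ _ _ _] := chP m gp.
have [q' q'c q'x] := IH _ _ (cg _ cch) qc qx; exists q' => //.
by apply/flatten_mapP; exists c.
Qed.

(** Upper regularity in the ball of [p] itself applies to all its children, at a factor 2 per
    generation. *)
Lemma desc_sum m k p : good p ->
  \sum_(q <- desc m k p) q.2 `^ d <= 2 ^+ k * p.2 `^ d.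
Proof.
elim: k m p => [|k IH] m p gp /=; first by rewrite big_seq1 expr0 mul1r.
have [_ cg cb cr _ creg _] := chP m gp.
rewrite big_flatten big_map/=.
apply: (@le_trans _ _ (\sum_(q <- ch m p) 2 ^+ k * q.2 `^ d)).
  by rewrite big_seq [leRHS]big_seq ler_sum// => q /cg; exact: IH.
rewrite -mulr_sumr exprSr -mulrA ler_wpM2l ?exprn_ge0//.
have := creg p.1 p.2 (ltW (good_gt0 gp)); apply: le_trans.
rewrite big_seq [leRHS]big_seq_cond le_eqVlt; apply/orP; left; apply/eqP.
apply: eq_bigl => q; have [qch/=|//] := boolP (q \in ch m p).
have /ballP -> := cb _ qch; have := cr _ qch; rewrite le_min => /andP[_ q2].
by apply/esym; have := good_gt0 gp; move: q2; lra.
Qed.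

(** * Lower bound for covers of a level of the tree *)

Section lower_bound.
Context (t : R) (lambda : nat -> R).
Hypothesis t0 : 0 < t.
Hypothesis td : t < d.
Hypothesis lambda_gt0 : forall m, 0 < lambda m.
Hypothesis lambdaS : forall m, lambda m = kappa * lambda m.+1.
Hypothesis lambda_scale : forall m,
  lambda m.+1 * 2 `^ (d + 1) * scale m `^ (d - t) <= 1.

Lemma powR_split x : x `^ d = x `^ (d - t) * x `^ t.
Proof. by rewrite -powRD subrK// gt_eqF. Qed.

(** The children hit lie in the ball of radius [2 * c.2], so upper regularity bounds their sum by 2
    (2 c.2)^d; the surplus power of exponent [d - t] is absorbed by [lambda_scale]. *)
Lemma multi_ball_sum m k p (c : X * R) : good p -> 0 <= c.2 <= scale m ->
  let hits q := has (fun e => mdist c.1 e.1 < c.2) (desc m.+1 k q) in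
  (1 < count hits (ch m p))%N ->
  lambda m.+1 * \sum_(q <- ch m p | hits q) q.2 `^ d <= c.2 `^ t.
Proof.
move=> gp /andP[c0 cm] hits multi.
have [us cg cb cr _ creg csep] := chP m gp.
have hit_near q : q \in ch m p -> hits q -> mdist c.1 q.1 < c.2 + 2 * q.2.
  move=> qch /hasP[e eq ce].
  have e0 : 0 < e.2 by exact/good_gt0/(desc_good (cg _ qch) eq).
  have : mdist q.1 e.1 <= 2 * q.2.
    by apply: (desc_subset (cg _ qch) eq); rewrite mdistxx mulr_ge0// ltW.
  by have := metric_triangle c.1 e.1 q.1; rewrite (metric_sym e.1); lra.
have hit_small q : q \in ch m p -> hits q ->
    (mdist c.1 q.1 < 2 * c.2) && (q.2 <= 2 * c.2).
  move=> qch qhit.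
  have [q' [q'ch q'hit qq']] : exists q', [/\ q' \in ch m p, hits q' & q != q'].
    have /allPn[q'] : ~~ all (pred1 q) [seq q' <- ch m p | hits q'].
      apply: contraTN multi => /allP hq; rewrite -leqNgt -size_filter.
      apply: (@uniq_leq_size _ _ [:: q]); first exact: filter_uniq.
      by move=> x /hq; rewrite inE.
    rewrite mem_filter => /andP[? ?] qq'; exists q'; split => //.
    by rewrite eq_sym.
  (* Adding the two separation bounds gives [q.2 + q'.2 < c.2]; either one then gives
     [q.2 < c.2 / 2]. *)
  have := hit_near _ qch qhit; have := hit_near _ q'ch q'hit.
  have := csep _ _ qch q'ch qq'; rewrite eq_sym in qq'.
  have := csep _ _ q'ch qch qq'; rewrite (metric_sym q'.1).
  have := metric_triangle q.1 c.1 q'.1; rewrite (metric_sym q.1 c.1).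
  have := good_gt0 (cg _ qch); have := good_gt0 (cg _ q'ch).
  by move=> *; apply/andP; split; lra.
apply: (@le_trans _ _ (lambda m.+1 * (2 * (2 * c.2) `^ d))).
  rewrite ler_wpM2l ?(ltW (lambda_gt0 _))//.
  have := creg c.1 (2 * c.2); rewrite mulr_ge0// => /(_ isT); apply: le_trans.
  rewrite -big_filter -[leRHS]big_filter; apply: sum_uniq_sub.
  - exact: filter_uniq.
  - by move=> q; rewrite !mem_filter => /andP[qhit qch]; rewrite qch hit_small.
  - by move=> q _; exact: powR_ge0.
rewrite powRM// (powR_split c.2) -[leRHS]mul1r !mulrA ler_wpM2r ?powR_ge0//.
apply: le_trans (lambda_scale m).
rewrite [2 `^ (d + 1)]powRD ?pnatr_eq0 ?implybT// powRr1// -!mulrA ler_wpM2l ?(ltW (lambda_gt0 _))//.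
rewrite mulrCA !ler_wpM2l ?powR_ge0//; apply: powR_le => //.
by rewrite subr_ge0 ltW.
Qed.

(* A ball that meets descendants of only one child is charged to that child by
   induction; a ball that meets several of them is large compared with all the
   children it meets, by separation, and is controlled by upper regularity. *)
Lemma cover_lower_bound k m p (S : seq (X * R)) : good p -> p.2 <= scale m ->
  (forall c, c \in S -> scale (m + k) <= c.2) ->
  (forall q, q \in desc m k p -> exists2 c, c \in S & mdist c.1 q.1 < c.2) ->
  lambda m * p.2 `^ d <= \sum_(c <- S) c.2 `^ t.
Proof.
(* A ball at least as large as the node pays for it alone. *)
have big_ball n q (S' : seq (X * R)) c : good q -> q.2 <= scale n ->
    c \in S' -> q.2 <= c.2 -> lambda n * q.2 `^ d <= \sum_(c <- S') c.2 `^ t.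
  move=> gq qn cS qc; have q0 := ltW (good_gt0 gq).
  apply: (@le_trans _ _ (c.2 `^ t)); last first.
    by rewrite (big_rem c)//= lerDl sumr_ge0// => *; exact: powR_ge0.
  apply: le_trans (powR_le (ltW t0) q0 qc).
  rewrite powR_split mulrA -[leRHS]mul1r ler_wpM2r ?powR_ge0//.
  apply: (@le_trans _ _ (lambda n * scale n `^ (d - t))).
    by rewrite ler_wpM2l ?(ltW (lambda_gt0 _))// powR_le// subr_ge0 ltW.
  apply: le_trans (lambda_scale n); rewrite ler_wpM2r ?powR_ge0// lambdaS.
  rewrite mulrC ler_wpM2l ?(ltW (lambda_gt0 _))//; apply: le_trans kappa_le1 _.
  have : 0 <= d + 1 by rewrite addr_ge0// ltW.
  by move/powR_le => /(_ 1 2 ler01); rewrite powR1 ler1n; apply.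
elim: k m p S => [|k IH] m p S gp pm Sscale Scov.
  have [|c cS _] := Scov p; first by rewrite inE.
  apply: (big_ball m p S c) => //; apply: le_trans pm _.
  by have := Sscale _ cS; rewrite addn0.
have [/hasP[c cS pc]|/hasPn Ssmall] := boolP (has (fun c => p.2 <= c.2) S).
  exact: (big_ball m p S c).
have [us cg cb cr cmass _ _] := chP m gp.
pose hits (c q : X * R) := has (fun e => mdist c.1 e.1 < c.2) (desc m.+1 k q).
pose multi c := (1 < count (hits c) (ch m p))%N.
(* The charge of [c] to a child [q] that it hits: the full weight of [q] if [c] hits several
   children, the full cost of [c] otherwise. *)
pose h c (q : X * R) := if multi c then lambda m.+1 * q.2 `^ d else c.2 `^ t.
have h0 c q : 0 <= h c q.
  by rewrite /h; case: ifP; rewrite ?mulr_ge0 ?powR_ge0// ltW.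
have per_child q : q \in ch m p ->
    lambda m.+1 * q.2 `^ d <= \sum_(c <- S | hits c q) h c q.
  move=> qch; rewrite -big_filter.
  have [/hasP[c cS cm]|/hasPn nmulti] :=
      boolP (has multi [seq c <- S | hits c q]).
    rewrite (big_rem c)//= {1}/h cm lerDl sumr_ge0// => *; exact: h0.
  rewrite (eq_big_seq (fun c => c.2 `^ t)); last first.
    by move=> c /nmulti; rewrite /h => /negbTE ->.
  apply: IH.
  - exact: cg.
  - by have := cr _ qch; rewrite le_min => /andP[].
  - by move=> c; rewrite mem_filter addSnnS => /andP[_ /Sscale].
  - move=> e eq; have [|c cS ce] := Scov e.
      by apply/flatten_mapP; exists q.
    by exists c => //; rewrite mem_filter cS andbT; apply/hasP; exists e.
have per_ball c : c \in S -> \sum_(q <- ch m p | hits c q) h c q <= c.2 `^ t.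
  move=> cS; rewrite /h; have [cm|cm] := boolP (multi c).
    rewrite -mulr_sumr; apply: multi_ball_sum => //.
    rewrite (le_trans _ (Sscale _ cS)) ?ltW ?scale_gt0//=.
    by apply: lt_le_trans pm; have := Ssmall _ cS; rewrite -ltNge.
  rewrite big_const_seq iter_addr_0 -[leRHS]mulr1n ler_wpMn2l ?powR_ge0//.
  by rewrite leqNgt.
(* Double counting of the pairs of a child and a ball hitting it; [kappa] is the fraction of mass
   kept by the children. *)
rewrite lambdaS (mulrC kappa) -mulrA.
apply: (@le_trans _ _ (\sum_(q <- ch m p) lambda m.+1 * q.2 `^ d)).
  by rewrite -mulr_sumr ler_wpM2l// ltW.
apply: (@le_trans _ _ (\sum_(q <- ch m p) \sum_(c <- S | hits c q) h c q)).
  by rewrite big_seq [leRHS]big_seq ler_sum.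
rewrite (exchange_big_dep predT)//= big_seq [leRHS]big_seq; exact: ler_sum.
Qed.

End lower_bound.

(** * The limit set of the tree *)

Section tree_limit.
Context (p0 : X * R).
Hypothesis complete_X : complete_space X.
Hypothesis good_p0 : good p0.
Hypothesis p0_le1 : p0.2 <= 1.

(** The doubled balls are nested along branches, and being closed they retain limits. *)
Definition level_set n : set X :=
  [set x | exists2 q, q \in desc 0 n p0 & mdist q.1 x <= 2 * q.2].

Definition tree_limit : set X := \bigcap_n level_set n.

Let p0_scale : p0.2 <= scale 0. Proof. by rewrite /scale expr0. Qed.

Lemma level_set_decr m n : (m <= n)%N -> level_set n `<=` level_set m.
Proof.
move=> /subnK <-; elim: (n - m)%N => [//|k IH] x [q qd qx].
rewrite addSn in qd.
by apply: IH; have [q' ? ?] := desc_parent good_p0 qd qx; exists q'.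
Qed.

(** The ultrafilter contains one ball of each level; the radii tend to 0, so it is Cauchy, and its
    limit lies in all these closed balls. *)
Lemma ultra_level_cvg (F : set_system X) : UltraFilter F ->
  (forall n, F (level_set n)) -> exists2 x, tree_limit x & F --> x.
Proof.
move=> FU FL.
have FB n : exists2 q, q \in desc 0 n p0 & F [set x | mdist q.1 x <= 2 * q.2].
  exact: ultra_seq (FL n).
have [|x Fx] := complete_X (F := F) _.
  move=> E; rewrite -entourage_ballE => -[e e0 eE].
  (* Two points of a doubled ball are at distance at most [4 * q.2], hence less than [e]. *)
  have e50 : 0 < e / 5 by rewrite divr_gt0.
  have [n ne] := scale_eventually_le e50; have [q qn Fq] := FB n.
  exists ([set x | mdist q.1 x <= 2 * q.2], [set x | mdist q.1 x <= 2 * q.2]).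
    by split.
  move=> [y z] [/= qy qz]; apply: eE; apply/ballP => /=.
  have := metric_triangle y q.1 z; rewrite (metric_sym y q.1).
  have := desc_scale good_p0 p0_scale qn; rewrite add0n.
  by move: ne qy qz e0; lra.
exists x => // n _; have [q qn Fq] := FB n; exists q => //.
apply/ler_addgt0Pr => e e0.
have Fe : F (ball x e) by apply: Fx; exact: nbhsx_ballx.
have [y [/ballP xy qy]] := filter_ex (filterI Fe Fq).
have := metric_triangle q.1 y x; rewrite (metric_sym y x).
by move: xy qy => /=; lra.
Qed.

Lemma tree_limit_compact : compact tree_limit.
Proof.
rewrite compact_ultra => F FU FK.
have [|x Kx Fx] := ultra_level_cvg FU; last by exists x.
by move=> n; apply: filterS FK => x; apply.
Qed.

(** The balls of level [n] are used as a cover. Of the surplus exponent [t - d], one half absorbs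
    the growth [kappa ^- n] of the sums and the other makes the total small. *)
Lemma tree_limit_null (t : R) : d < t -> null t tree_limit.
Proof.
move=> dt a a0; have u0 : 0 < (t - d) / 2 by rewrite divr_gt0// subr_gt0.
have [B B0 scaleB] := scale_decay u0.
pose M := 3 `^ t * B * p0.2 `^ d.
have M0 : 0 < M by rewrite !mulr_gt0 ?powR_gt0//; exact: good_gt0.
have [n nsmall] := scale_eventually_le (powR_gt0 ((t - d) / 2)^-1 (divr_gt0 a0 M0)).
have q_gt0 q : q \in desc 0 n p0 -> 0 < q.2.
  by move=> qn; exact/good_gt0/(desc_good good_p0 qn).
exists ((fun q => (q.1, 3 * q.2)) @` [set` desc 0 n p0]); split.
- exact/finite_set_countable/finite_image/finite_seq.
- by move=> _ [q /= /q_gt0 q0 <-]; rewrite mulr_gt0.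
- move=> x /(_ n Logic.I)[q qn qx]; exists (q.1, 3 * q.2); first by exists q.
  by apply/ballP => /=; move: (q_gt0 _ qn) qx; lra.
apply: (@finsum_le_image _ _ _ _ _ _
    (fun q => 3 `^ t * scale n `^ (t - d) * q.2 `^ d)).
  move=> q /= qn; have q0 := q_gt0 _ qn.
  rewrite powR_ge0/= powRM ?(ltW q0)// -mulrA ler_wpM2l ?powR_ge0//.
  have -> : q.2 `^ t = q.2 `^ (t - d) * q.2 `^ d.
    by rewrite -powRD subrK// gt_eqF// (lt_trans d0).
  rewrite ler_wpM2r ?powR_ge0//; apply: powR_le; [|exact: ltW|].
    by rewrite subr_ge0 ltW.
  exact: desc_scale p0_scale qn.
move=> s us sn; rewrite -mulr_sumr.
have sum_le : \sum_(q <- s) q.2 `^ d <= kappa ^- n * p0.2 `^ d.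
  apply: (@le_trans _ _ (\sum_(q <- desc 0 n p0) q.2 `^ d)).
    by apply: sum_uniq_sub => // q _; exact: powR_ge0.
  apply: le_trans (desc_sum _ _ good_p0) _; rewrite ler_wpM2r ?powR_ge0//.
  rewrite -[2]invrK exprVn lef_pV2 ?posrE ?exprn_gt0 ?invr_gt0//.
  by apply: lerXn2r => //; rewrite nnegrE ?invr_ge0// ltW.
apply: le_trans (ler_wpM2l _ sum_le) _; first by rewrite mulr_ge0 ?powR_ge0.
rewrite [t - d]splitr powRD; last first.
  by apply/implyP => _; rewrite gt_eqF ?scale_gt0.
set v := scale n `^ _.
have vM : v <= a / M.
  have := powR_le (ltW u0) (ltW (scale_gt0 n)) nsmall.
  by rewrite root_powR// ltW// divr_gt0.
apply: (@le_trans _ _ (M * v)); last first.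
  by rewrite mulrC -ler_pdivlMr.
have -> : 3 `^ t * (v * v) * (kappa ^- n * p0.2 `^ d) =
    (3 `^ t * p0.2 `^ d * v) * (kappa ^- n * v) by ring.
have -> : M * v = (3 `^ t * p0.2 `^ d * v) * B by rewrite /M; ring.
by rewrite ler_wpM2l ?mulr_ge0 ?powR_ge0//; exact: scaleB.
Qed.

(** A finite stage has to cover a whole level, as the lower bound speaks of levels. Otherwise
    uncovered points of each level form a sequence, and an ultrafilter containing its tails
    converges to a point of the limit set inside some ball of the cover. *)
Lemma tree_limit_finite_cover (S : nat -> seq (X * R)) :
  (forall m n, (m <= n)%N -> {subset S m <= S n}) ->
  (forall x, tree_limit x -> exists n, exists2 c, c \in S n & ball c.1 c.2 x) ->
  exists n, forall x, level_set n x -> exists2 c, c \in S n & ball c.1 c.2 x.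
Proof.
move=> Smono Scov; apply: contrapT => /forallNP nS.
have /choice[x xP] : forall n, exists x, level_set n x /\
    ~ exists2 c, c \in S n & ball c.1 c.2 x.
  by move=> n; have /existsNP[x /not_implyP[? ?]] := nS n; exists x.
have [F [FU xF]] := ultraFilterLemma (fmap_proper_filter x eventually_filter).
have Fn (A : set X) n : (forall m, (n <= m)%N -> A (x m)) -> F A.
  by move=> nA; apply: xF; exists n => // m /=; exact: nA.
have [|y Ky Fy] := ultra_level_cvg FU.
  by move=> n; apply: (Fn _ n) => m nm; apply: level_set_decr nm _ (xP m).1.
have [n [c cS /ballP cy]] := Scov _ Ky.
have Fc : F (ball c.1 c.2).
  apply: Fy; apply/nbhs_ballP; exists (c.2 - mdist c.1 y) => /=.
    by rewrite subr_gt0.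
  move=> z /ballP yz; apply/ballP; have := metric_triangle c.1 y z.
  by move: yz; lra.
have Fnc : F (~` ball c.1 c.2).
  apply: (Fn _ n) => m nm cx; apply: (xP m).2; exists c => //.
  exact: Smono nm _ cS.
by have [z []] := filter_ex (filterI Fc Fnc).
Qed.

(** A cover of total at most [b / 2] would contradict the lower bound [b] given by the root. *)
Lemma tree_limit_not_null (t : R) : 0 < t -> t < d -> ~ null t tree_limit.
Proof.
move=> t0 td K0; have u0 : 0 < d - t by rewrite subr_gt0.
have [B B0 scaleB] := scale_decay u0.
(* Normalised so that [lambda_scale] becomes the bound [scaleB] divided by [B]. *)
pose gamma := kappa / (2 `^ (d + 1) * B).
have gamma0 : 0 < gamma by rewrite divr_gt0// mulr_gt0// powR_gt0.
pose lambda m := gamma * kappa ^- m.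
have lambda_gt0 m : 0 < lambda m by rewrite mulr_gt0// invr_gt0 exprn_gt0.
have lambdaS m : lambda m = kappa * lambda m.+1.
  by rewrite /lambda exprS invfM mulrCA mulVKf// gt_eqF.
have lambda_scale m : lambda m.+1 * 2 `^ (d + 1) * scale m `^ (d - t) <= 1.
  have -> : lambda m.+1 * 2 `^ (d + 1) * scale m `^ (d - t) =
      kappa ^- m * scale m `^ (d - t) / B.
    rewrite /lambda /gamma exprS; field.
    by rewrite !gt_eqF ?exprn_gt0 ?powR_gt0.
  by rewrite ler_pdivrMr// mul1r.
pose b := lambda 0%N * p0.2 `^ d.
have b0 : 0 < b by rewrite mulr_gt0 ?powR_gt0//; exact: good_gt0.
have b20 : 0 < b / 2 by rewrite divr_gt0.
have [C [cC C0 KC Cb]] := K0 _ b20.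
have [S [Su SC Smono CS]] := countable_exhaustion cC.
have [|n nS] := tree_limit_finite_cover Smono.
  move=> x /KC[c Cc cx]; have [n cn] := CS _ Cc.
  by exists n, c.
(* The level [m] is deep enough both to be covered by [S n] and to have scale below all radii in
   [S n]. *)
have [m [nm mS]] : exists m, (n <= m)%N /\ forall c, c \in S n -> scale m <= c.2.
  have: forall c, c \in S n -> 0 < c.2 by move=> c /SC/C0.
  elim: (S n) => [|c s IH] s0; first by exists n.
  have [|m [nm ms]] := IH; first by move=> c' c's; apply: s0; rewrite inE c's orbT.
  have [m' m'c] := scale_eventually_le (s0 _ (mem_head _ _)).
  exists (maxn m m'); split; first by rewrite (leq_trans nm)// leq_maxl.
  move=> c'; rewrite inE => /predU1P[->|/ms].
    by apply: le_trans m'c; rewrite scale_le// leq_maxr.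
  by apply: le_trans; rewrite scale_le// leq_maxl.
have := cover_lower_bound t0 td lambda_gt0 lambdaS lambda_scale good_p0 p0_scale
  (k := m) (S := S n).
rewrite add0n => /(_ mS) lb.
have : b <= b / 2.
  apply: le_trans (lb _) (Cb _ (Su n) (SC n)) => q qm.
  have [|c cS /ballP ?] := nS q.1; last by exists c.
  apply: (level_set_decr nm); exists q => //.
  by rewrite mdistxx mulr_ge0// ltW// good_gt0//; exact: (desc_good good_p0 qm).
by move: b0; lra.
Qed.

End tree_limit.
End tree.

(** * Dimension *)

Section dimension.
Local Open Scope ring_scope.
Context {R : realType} {X : metricType R}.
Implicit Types (E : set X) (d t : R).

(** If the measure at [s < d] were finite, the set would be null at the midpoint of [s] and [d],
    which is positive even for [s = 0]. *)
Lemma hausdorff_dim_critical E d : 0 <= d ->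
  (forall t, d < t -> null t E) ->
  (forall t, 0 < t -> t < d -> ~ null t E) -> hausdorff_dim E = d%:E.
Proof.
move=> d0 above below; apply/hausdorff_dimP; split=> [|s s0|s s0].
- by rewrite lee_fin.
- rewrite lte_fin => sd; apply: contrapT => /eqP; rewrite -ltey => Hs.
  have [st td] := midf_lt sd; have t0 := le_lt_trans s0 st.
  by apply: (below _ t0 td); apply/hausdorff_measure0_null/(hausdorff_measure_eq0 s0 st).
- rewrite lte_fin => ds; apply: null_hausdorff_measure0; last exact: above.
  exact: le_lt_trans ds.
Qed.

Lemma hausdorff_dim_set1 (x : X) : hausdorff_dim [set x] = 0%E.
Proof.
apply: hausdorff_dim_critical => // t; last by move=> t0 /(lt_trans t0); rewrite ltxx.
move=> t0 a a0; rewrite -(root_powR t0 (ltW a0)).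
apply: (@covered_le _ _ _ _ _ _ _ _ _ (covered_ball t x (powR_gt0 _ a0))) => //.
by move=> _ ->; apply/ballP; rewrite mdistxx powR_gt0.
Qed.

Lemma hausdorff_dim_gt_not_null E d : 0 < d ->
  (d%:E < hausdorff_dim E)%E -> ~ null d E.
Proof.
move=> d0 dE /(null_hausdorff_measure0 d0) Hd.
have [_ /(_ d (ltW d0) dE) + _] := (hausdorff_dimP E _).1 erefl.
by rewrite Hd.
Qed.

Lemma compact_subset_dim (d : R) : complete_space X -> separable_space X ->
  0 < d -> (d%:E < hausdorff_dim [set: X])%E ->
  exists K : set X, compact K /\ hausdorff_dim K = d%:E.
Proof.
move=> complete_X separable_X d0 dX.
have [x xreg] : exists x : X, regular d x.
  apply: contrapT => noreg; apply: (hausdorff_dim_gt_not_null d0 dX).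
  have -> : [set: X] = ~` regular d.
    by apply/esym; rewrite -subTset => y _ yreg; apply: noreg; exists y.
  exact: null_nonregular.
have [r r1 xr] := xreg 1 ltr01.
(* Children are chosen for every level and node at once, with the empty list as default at bad
   nodes. *)
have /choice[ch chP] : forall mp : nat * (X * R), exists s, good_node d mp.2 ->
    child_family d (good_node d) (mass_cst d) mp.2
      (Num.min (scale (mass_cst d) mp.1.+1) (mp.2.2 / 2)) s.
  move=> [m p]; have [gp|] := pselect (good_node d p); last by exists [::].
  have [|s ?] := child_family_exists separable_X d0 gp (eps :=
      Num.min (scale (mass_cst d) m.+1) (p.2 / 2)); last by exists s.
  rewrite lt_min scale_gt0; last exact: mass_cst_gt0.
  by rewrite divr_gt0// gp.2.1.
have good_gt0 (p : X * R) : good_node d p -> (0 < p.2)%R by move=> [_ []].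
have xgood : good_node d (x, r) by [].
have k0 := mass_cst_gt0 d.
have k1 : mass_cst d <= 2^-1 := mass_cst_le d0.
pose K := tree_limit (fun m p => ch (m, p)) (x, r).
have chP' m p := chP (m, p).
exists K; split.
  exact: (tree_limit_compact k0 k1 chP' complete_X xgood r1).
apply: hausdorff_dim_critical; first exact: ltW.
  move=> t; exact: (tree_limit_null d0 k0 k1 good_gt0 chP' xgood r1).
move=> t; exact: (tree_limit_not_null d0 k0 k1 good_gt0 chP' complete_X xgood r1).
Qed.

End dimension.

Theorem theorem4 (R : realType) (X : metricType R)
    (complete_X : complete_space X) (separable_X : separable_space X)
    (d : R) (d_ge0 : (0 <= d)%R)
    (d_lt_dim : d%:E < hausdorff_dim [set: X]) :
  exists K : set X, compact K /\ hausdorff_dim K = d%:E.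
Proof.
have [d0|d0] := eqVneq d 0%R.
  have [[x _]|X0] := pselect (exists x : X, True).
    by exists [set x]; rewrite d0; split; [exact: compact_set1|exact: hausdorff_dim_set1].
  (* The empty space has dimension 0, contrary to the strict inequality assumed. *)
  have : hausdorff_dim [set: X] = 0; last by move=> H; rewrite H d0 ltxx in d_lt_dim.
  apply: hausdorff_dim_critical => // t.
    move=> t0 a a0; apply: (@covered_le _ _ t _ set0 _ a) => //.
      by move=> x _; apply: X0; exists x.
    exact/covered_set0/ltW.
  by move=> t0 /(lt_trans t0); rewrite ltxx.
apply: compact_subset_dim => //.
by rewrite lt_neqAle eq_sym d0.
Qed.
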